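(* Let $G=(L,R,E)$ be a finite bipartite graph whose vertex set $R$ is equipped with a linear ordering. Then for every matching $M$ in $G$ there exists a linear ordering $\succ$ of the vertices of $L$ such that the order of the greedy matching $M^\succ_G$ is less than or equal to the order of $M$ (in particular, if $M$ is $L$-saturating then so is $M^\succ_G$).
   Context: Let $y_1\succ y_2\succ\dots\succ y_N$ be the vertices of $R$ listed in order of preference. A matching $M$ is $L$-saturating if every vertex of $L$ is matched by $M$. The order of a matching $M$ is the smallest $k$ such that $M$ is $L$-saturating and leaves $y_{k+1},\dots,y_N$ unmatched; if $M$ is not $L$-saturating its order is $\infty$. Given a linear ordering $\succ$ of $L$, the greedy matching $M^\succ_G$ is the matching produced by the following procedure: start with $M=\emptyset$; while $M$ is not a maximal matching, let $L_M$ be the set of vertices of $L$ unmatched by $M$ that are adjacent to some vertex of $R$ unmatched by $M$, $R_M$ analogously, let $x^*$ be the most preferred vertex of $L_M$, let $y^*$ be the most preferred vertex of $R_M$ adjacent to $x^*$, and add the edge $\{x^*,y^*\}$ to $M$; return $M$ when it is maximal. *)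

(* Defs.v *)
From mathcomp Require Import all_boot.

Set Implicit Arguments.
Unset Strict Implicit.
Unset Printing Implicit Defensive.

(* [r x y] reads "x is preferred to y". *)
Definition strict_linear_order (T : eqType) (r : rel T) : Prop :=
  [/\ irreflexive r, transitive r & forall x y, x != y -> r x y || r y x].

Definition most_preferred (T : finType) (r : rel T) (A : {set T}) : option T :=
  [pick x in A | [forall z in A, (z != x) ==> r x z]].

(* The index i such that y = y_i when y_1, y_2, ..., y_N lists the elements of
   T from most to least preferred. *)
Definition pref_index (T : finType) (r : rel T) (y : T) : nat :=
  #|[set z | (z == y) || r z y]|.

(* Order of values in nat extended with infinity, encoded as None. *)
Definition le_ext (a b : option nat) : bool :=
  match a, b with
  | _, None => true
  | None, Some _ => false
  | Some m, Some n => m <= n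
  end.

(* A bipartite graph (L, R, E) is given by its parts L and R and by its edge set
   E : {set L * R}; a set of edges M : {set L * R} may be a matching or not. *)
Section Matchings.
Variables L R : finType.
Implicit Types (E M : {set L * R}) (rL : rel L) (rR : rel R).

Definition matching E : pred {set L * R} := fun M =>
  (M \subset E) &&
  [forall e in M, forall f in M,
     ((e.1 == f.1) || (e.2 == f.2)) ==> (e == f)].

Definition maximal_matching E M : bool := maxset (matching E) M.

Definition matchedL M : {set L} := [set e.1 | e in M].
Definition matchedR M : {set R} := [set e.2 | e in M].

Definition saturating M : bool := [forall x : L, x \in matchedL M].

Definition unmatched_beyond rR M : pred nat := fun k =>
  [forall y : R, (k < pref_index rR y) ==> (y \notin matchedR M)].

Lemma unmatched_beyond_ex rR M : exists k, unmatched_beyond rR M k.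
Proof.
exists #|R|; apply/forallP => y; apply/implyP.
by rewrite ltnNge max_card.
Qed.

Definition matching_order rR M : option nat :=
  if saturating M then Some (ex_minn (unmatched_beyond_ex rR M)) else None.

Definition availL E M : {set L} :=
  [set x | (x \notin matchedL M) &&
           [exists y, (y \notin matchedR M) && ((x, y) \in E)]].
Definition availR E M : {set R} :=
  [set y | (y \notin matchedR M) &&
           [exists x, (x \notin matchedL M) && ((x, y) \in E)]].

Definition greedy_step E rL rR M : {set L * R} :=
  if maximal_matching E M then M else
  if most_preferred rL (availL E M) is Some x then
    if most_preferred rR [set y in availR E M | (x, y) \in E] is Some y
    then (x, y) |: M else M
  else M.

(* Each step that does not stop matches a new vertex of L, so #|L| steps run
   the loop to its end; greedy_matching_maximal below checks this. *)
Definition greedy_matching E rL rR : {set L * R} :=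
  iter #|L| (greedy_step E rL rR) set0.

End Matchings.

Lemma most_preferred_ex (T : finType) (r : rel T) (A : {set T}) :
  strict_linear_order r -> A != set0 ->
  exists2 x, most_preferred r A = Some x & x \in A.
Proof.
move=> [irr tr tot] /set0Pn[a aA].
rewrite /most_preferred; case: pickP => [x /andP[xA _]|no]; first by exists x.
case: (@arg_minnP T a (mem A) (fun x => #|[set z in A | r z x]|) aA) => x xA xmin.
have /negbT := no x; rewrite /= [x \in A]xA /= => /forallPn[z].
rewrite !negb_imply => /and3P[zA zx nxz].
have rzx : r z x by have := tot z x zx; rewrite (negbTE nxz) orbF.
have : #|[set w in A | r w z]| < #|[set w in A | r w x]|.
  apply: proper_card; apply/properP; split.
    by apply/subsetP => w; rewrite !inE => /andP[-> /tr]; apply.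
  by exists z; rewrite !inE zA /= ?rzx ?irr.
by rewrite ltnNge xmin.
Qed.

Section GreedyCorrect.
Variables (L R : finType) (E : {set L * R}) (rL : rel L) (rR : rel R).
Hypotheses (oL : strict_linear_order rL) (oR : strict_linear_order rR).
Implicit Types M : {set L * R}.

Lemma maximal_step M :
  maximal_matching E M -> greedy_step E rL rR M = M.
Proof. by rewrite /greedy_step => ->. Qed.

Lemma matchingP M :
  reflect (M \subset E /\
           {in M &, forall e f, e.1 = f.1 \/ e.2 = f.2 -> e = f})
          (matching E M).
Proof.
apply: (iffP andP) => -[sME dM]; split=> //.
  move=> e f eM fM h; apply/eqP.
  have /forallP/(_ f)/implyP/(_ fM)/implyP := implyP (forallP dM e) eM.
  by apply; case: h => ->; rewrite eqxx ?orbT.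
apply/forallP => e; apply/implyP => eM; apply/forallP => f; apply/implyP => fM.
by apply/implyP => h; apply/eqP/dM => //; case/orP: h => /eqP; [left|right].
Qed.

Lemma matchingU1 M x y : matching E M -> (x, y) \in E ->
  x \notin matchedL M -> y \notin matchedR M -> matching E ((x, y) |: M).
Proof.
move=> /matchingP[sME dM] xyE xM yM.
have n e : e \in M -> ~ (x = e.1 \/ y = e.2).
  by move=> eM [h|h]; [case/negP: xM|case/negP: yM];
     rewrite h; apply: imset_f.
apply/matchingP; split; first by rewrite subUset sub1set xyE.
move=> e f; rewrite !inE => /predU1P[->|eM] /predU1P[->|fM] //.
- by move=> /(n f fM).
- by move=> h; case: (n e eM); case: h => /= ->; [left|right].
exact: dM.
Qed.

Lemma matching_availL M :
  matching E M -> ~~ maximal_matching E M -> availL E M != set0.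
Proof.
move=> mM; apply: contraNneq => noL; apply/maxsetP; split=> // M' mM' sMM'.
apply/eqP; rewrite eqEsubset sMM' andbT; apply/subsetP => -[x y] xyM'.
case/matchingP: mM' => /subsetP sM'E dM'.
have d e : e \in M -> x = e.1 \/ y = e.2 -> (x, y) \in M.
  by move=> eM h; rewrite (dM' (x, y) e) // (subsetP sMM').
have : x \notin availL E M by rewrite noL inE.
rewrite inE negb_and negbK => /orP[/imsetP[e eM ex]|].
  by apply: (d e) => //; left.
move=> /existsPn/(_ y); rewrite sM'E // andbT negbK => /imsetP[e eM ey].
by apply: (d e) => //; right.
Qed.

Lemma greedy_stepP M : matching E M -> ~~ maximal_matching E M ->
  matching E (greedy_step E rL rR M) /\
  #|greedy_step E rL rR M| = #|M|.+1.
Proof.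
move=> mM nmM; rewrite /greedy_step (negbTE nmM).
have [x -> xA] := most_preferred_ex oL (matching_availL mM nmM).
move: xA; rewrite inE => /andP[xM /existsP[y0 /andP[y0M xy0]]].
have [|y -> ] := @most_preferred_ex _ rR [set y in availR E M | (x, y) \in E] oR.
  apply/set0Pn; exists y0; rewrite !inE xy0 y0M /= andbT.
  by apply/existsP; exists x; rewrite xM.
rewrite !inE => /andP[/andP[yM _] xyE]; split; first exact: matchingU1.
by rewrite cardsU1 (contra _ xM) // => xyM; apply/imsetP; exists (x, y).
Qed.

Lemma matching_card M : matching E M -> #|M| <= #|L|.
Proof.
case/matchingP=> _ dM.
rewrite -(card_in_imset (f := fst) (D := mem M)) ?max_card // => e f eM fM ef.
by apply: dM => //; left.
Qed.

Lemma greedy_matching_maximal :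
  maximal_matching E (greedy_matching E rL rR).
Proof.
have m0 : matching E set0.
  by rewrite /matching sub0set; apply/forallP => e; rewrite inE.
have loop n : let M := iter n (greedy_step E rL rR) set0 in
    maximal_matching E M \/ matching E M /\ #|M| = n.
  elim: n => [|n /= [mx|[mM cM]]]; first by right; rewrite cards0.
    by left; rewrite maximal_step.
  set M := iter _ _ _ in mM cM *.
  have [mx|nmx] := boolP (maximal_matching E M).
    by left; rewrite maximal_step.
  by right; have [? ->] := greedy_stepP mM nmx; rewrite cM.
have [//|[mM cM]] := loop #|L|.
rewrite -/(greedy_matching E rL rR) in mM cM *.
apply: contraT => nmx; have [m' c'] := greedy_stepP mM nmx.
by have := matching_card m'; rewrite c' cM ltnn.
Qed.

End GreedyCorrect.

(* Main.v *)
(* Build the ordering of L one vertex at a time, keeping an L-saturating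
   matching N, of order at most that of M, that contains the greedy matching P
   of the vertices ranked so far.  Let y be the most preferred vertex of R still
   available to P.  If N matches y to some x, then y is the best choice of x, so
   x may be ranked next.  Otherwise rank next any available neighbour x of y and
   let N match x to y instead of its former, less preferred partner. *)
Require Import Defs.
From mathcomp Require Import all_boot.

Set Implicit Arguments.
Unset Strict Implicit.
Unset Printing Implicit Defensive.

Lemma most_preferredP (T : finType) (r : rel T) (A : {set T}) x :
  strict_linear_order r ->
  reflect (x \in A /\ {in A, forall z, z != x -> r x z})
          (most_preferred r A == Some x).
Proof.
move=> [irr tr _]; rewrite /most_preferred; apply: (iffP eqP) => [|[xA xmin]].
  case: pickP => // w /andP[wA wmin] [<-]; split=> // z zA zw.
  by apply: (implyP (implyP (forallP wmin z) zA)).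
case: pickP => [w /andP[wA wmin]|/(_ x)]; last first.
  rewrite /= xA /= => /negP[]; apply/forallP => z; apply/implyP => zA.
  exact/implyP/xmin.
congr Some; apply/eqP; apply: contraT => wx.
have rxw := xmin w wA wx.
have rwx : r w x.
  by apply: (implyP (implyP (forallP wmin x) xA)); rewrite eq_sym.
by have := tr _ _ _ rxw rwx; rewrite irr.
Qed.

Lemma leq_pref_index (T : finType) (r : rel T) x y :
  strict_linear_order r -> r x y -> pref_index r x <= pref_index r y.
Proof.
move=> [_ tr _] rxy; apply/subset_leq_card/subsetP => z; rewrite !inE.
by case/predU1P => [->|/tr/(_ rxy) ->]; rewrite ?rxy orbT.
Qed.

(** Elements missing from [s] would all share the index [size s], so comparability relies on [s]
    listing all of [T]. *)
Lemma index_strict_linear_order (T : finType) (s : seq T) :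
  (forall x, x \in s) -> strict_linear_order (fun x y => index x s < index y s).
Proof.
move=> s_all; split=> [x|y x z|x y]; first exact: ltnn.
  exact: ltn_trans.
rewrite -neq_ltn; apply: contraNneq => eq_i.
by rewrite -(nth_index x (s_all x)) eq_i nth_index.
Qed.

Section Greedy.
Variables (L R : finType) (E : {set L * R}).
Implicit Types (M N P : {set L * R}) (rL : rel L) (rR : rel R).

Lemma unmatched_beyondP rR M k :
  reflect {in M, forall e, pref_index rR e.2 <= k} (unmatched_beyond rR M k).
Proof.
apply: (iffP forallP) => [h e eM|h y].
  rewrite leqNgt; apply/negP => /(implyP (h e.2)) /negP[]; exact: imset_f.
rewrite ltnNge; apply/implyP; apply: contra => /imsetP[e eM ->]; exact: h.
Qed.

Lemma matchingS M N : matching E M -> N \subset M -> matching E N.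
Proof.
move=> /matchingP[sME dM] sNM; apply/matchingP; split.
  exact: subset_trans sME.
by move=> e f /(subsetP sNM) eM /(subsetP sNM) fM; apply: dM.
Qed.

(** An exchange argument: [N] matches each vertex of [L] outside [P] to a vertex available to [P],
    hence to one no better than the best available [y]. The vertex [x0] ensures that such a [y]
    exists. *)
Lemma extend_by_best rR P N k x0 :
    strict_linear_order rR -> matching E N -> saturating N ->
    unmatched_beyond rR N k -> P \subset N -> x0 \notin matchedL P ->
  exists x y N', [/\ most_preferred rR (availR E P) = Some y,
    x \notin matchedL P & (x, y) |: P \subset N'] /\
    [/\ matching E N', saturating N' & unmatched_beyond rR N' k].
Proof.
move=> oR mN satN /unmatched_beyondP bN sPN x0P.
have [sNE dN] := matchingP _ _ mN.
have partner x : x \notin matchedL P ->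
    exists2 y, (x, y) \in N & y \in availR E P.
  move=> xP; have /imsetP[[x' y] xyN /= ex] := forallP satN x; subst x'.
  exists y => //; rewrite inE; apply/andP; split; last first.
    by apply/existsP; exists x; rewrite xP (subsetP sNE).
  (* An edge of [P] at [y] lies in [N], so it is [(x, y)] and [P] would match [x]. *)
  apply: contra xP => /imsetP[e eP ey]; apply/imsetP; exists e => //.
  have -> // : e = (x, y).
  by apply: dN => //; [apply: (subsetP sPN)|right].
have [y0 _ y0A] := partner _ x0P.
have [|y ybest] := @most_preferred_ex _ rR (availR E P) oR.
  by apply/set0Pn; exists y0.
have /(most_preferredP _ _ oR)[yA ymin] : most_preferred rR (availR E P) == Some y
  by apply/eqP.
move=> _; have := yA; rewrite inE => /andP[yP /existsP[x /andP[xP xyE]]].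
have [/imsetP[[x1 y1] eN /= ey]|yN] := boolP (y \in matchedR N).
  subst y1; exists x1, y, N; split; split=> //; last exact/unmatched_beyondP.
    apply: contra yP => /imsetP[e eP ex]; apply/imsetP; exists e => //.
    have -> // : e = (x1, y).
    by apply: dN => //; [apply: (subsetP sPN)|left].
  by rewrite subUset sub1set eN.
have [y1 xy1N y1A] := partner _ xP.
exists x, y, ((x, y) |: N :\ (x, y1)); split; split=> //.
- rewrite setUS //; apply/subsetP => e eP; rewrite !inE (subsetP sPN) // andbT.
  by apply: contraNneq xP => ee; apply/imsetP; exists e => //; rewrite ee.
- apply: matchingU1 => //; first exact: matchingS (subsetDl _ _).
    apply/imsetP => -[e]; rewrite !inE => /andP[/eqP ne eN] ex; case: ne.
    by apply: dN => //; left.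
  apply: contra yN => /imsetP[e]; rewrite !inE => /andP[_ eN] ->.
  exact: imset_f.
- apply/forallP => z; apply/imsetP; have [->|zx] := eqVneq z x.
    by exists (x, y); rewrite // !inE eqxx.
  have /imsetP[e eN ez] := forallP satN z; exists e => //.
  rewrite !inE eN andbT; apply/orP; right; apply: contraNneq zx => ee.
  by rewrite ez ee.
- apply/unmatched_beyondP => e; rewrite !inE => /predU1P[->|/andP[_ /bN]] //=.
  (* The new edge inherits the bound of the edge [(x, y1)] that it replaces. *)
  apply: leq_trans (bN _ xy1N); have [<- //|ny] := eqVneq y1 y.
  exact/leq_pref_index/ymin.
Qed.

(** Being best among all available vertices, [y] is also best among the neighbours of [x]. The
    larger matching [(x, y) |: P] shows that the loop does not stop at [P]. *)
Lemma greedy_step_best rL rR P x y :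
    strict_linear_order rL -> strict_linear_order rR ->
    matching E ((x, y) |: P) -> x \notin matchedL P ->
    most_preferred rR (availR E P) = Some y ->
    {in availL E P, forall z, z != x -> rL x z} ->
  greedy_step E rL rR P = (x, y) |: P.
Proof.
move=> oL oR mxyP xP /eqP/(most_preferredP _ _ oR)[yA ymin] xmin.
have xyE : (x, y) \in E.
  by have [/subsetP-> //] := matchingP _ _ mxyP; rewrite setU11.
have xA : x \in availL E P.
  rewrite inE xP; apply/existsP; exists y; rewrite xyE andbT.
  by move: yA; rewrite inE => /andP[].
have /negbTE nmax : ~~ maximal_matching E P.
  apply/negP => /maxsetP[_ /(_ _ mxyP (subsetUr _ _)) eqxyP].
  by case/negP: xP; apply/imsetP; exists (x, y); rewrite // -eqxyP setU11.
rewrite /greedy_step nmax.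
have /eqP-> : most_preferred rL (availL E P) == Some x.
  exact/most_preferredP.
have /eqP-> // :
    most_preferred rR [set y in availR E P | (x, y) \in E] == Some y.
apply/most_preferredP => //; split; first by rewrite inE yA.
by move=> z; rewrite inE => /andP[zA _]; apply: ymin.
Qed.

(* [index x s = size s] when [x] is not in [s], so the hypothesis on [rL] says
   that [s] is an initial segment of [rL]. *)
Lemma greedy_prefix rR M k n :
    strict_linear_order rR -> matching E M -> saturating M ->
    unmatched_beyond rR M k -> n <= #|L| ->
  exists (s : seq L) P N,
    [/\ uniq s, size s = n, matchedL P =i s & forall rL,
        strict_linear_order rL ->
        (forall x z, index x s < index z s -> rL x z) ->
        iter n (greedy_step E rL rR) set0 = P] /\
    [/\ P \subset N, matching E N, saturating N & unmatched_beyond rR N k].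
Proof.
move=> oR mM satM bM; elim: n => [|n IHn] nL.
  exists [::], set0, M; split; split=> //; last exact: sub0set.
  by move=> x; rewrite in_nil; apply/imsetP => -[e]; rewrite inE.
have [s [P [N [[us sz sP run] [sPN mN satN bN]]]]] := IHn (ltnW nL).
have [x0 x0s] : exists x0, x0 \notin s.
  apply/existsP; apply: contraTT nL => /existsPn s_all.
  rewrite -leqNgt -sz -(card_uniqP us); apply/subset_leq_card/subsetP => x _.
  by have := s_all x; rewrite negbK.
rewrite -sP in x0s.
have [x [y [N' [[ybest xP sPN'] [mN' satN' bN']]]]] :=
  extend_by_best oR mN satN bN sPN x0s.
have xs : x \notin s by rewrite -sP.
exists (rcons s x), ((x, y) |: P), N'; split; split=> //.
- by rewrite rcons_uniq xs us.
- by rewrite size_rcons sz.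
- by move=> z; rewrite /matchedL imsetU1 in_setU1 mem_rcons in_cons -/(matchedL P) sP.
move=> rL oL agree; rewrite iterS run //.
  apply: greedy_step_best => //; first exact: matchingS mN' sPN'.
  move=> z; rewrite inE sP => /andP[zs _] zx; apply: agree.
  (* In [rcons s x], the vertex [x] has index [size s], and every other vertex outside [s] has index
     [size s + 1]. *)
  rewrite -cats1 !index_cat (negbTE xs) (negbTE zs) /= eqxx eq_sym (negbTE zx).
  by rewrite addn0 addn1.
(* An ordering with initial segment [rcons s x] also has initial segment [s]: here [u] lies in [s]
   and keeps its index, and that of [v] stays above it. *)
move=> u v uv; apply: agree; rewrite -cats1 !index_cat.
have us' : u \in s by rewrite -index_mem; apply: leq_trans uv (index_size _ _).
by rewrite us'; case: ifP => // _; rewrite ltn_addr ?index_mem.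
Qed.

End Greedy.

Theorem theorem2 (L R : finType) (E : {set L * R}) (rR : rel R)
    (linR : strict_linear_order rR)
    (M : {set L * R}) (hM : matching E M) :
  exists rL : rel L,
    [/\ strict_linear_order rL,
        le_ext (matching_order rR (greedy_matching E rL rR))
               (matching_order rR M)
      & saturating M -> saturating (greedy_matching E rL rR)].
Proof.
have [satM|nsatM] := boolP (saturating M); last first.
  (* The order of [M] is infinite, so any ordering of [L] will do. *)
  exists (fun x z => index x (enum L) < index z (enum L)); split=> //.
    by apply: index_strict_linear_order => x; rewrite mem_enum.
  by rewrite [matching_order rR M]/matching_order (negbTE nsatM); case: matching_order.
rewrite [matching_order rR M]/matching_order satM.
case: ex_minnP => k bM _.
have [s [P [N [[us sz sP run] [sPN mN satN bN]]]]] :=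
  greedy_prefix linR hM satM bM (leqnn #|L|).
have s_all x : x \in s.
  have [//|xs] := boolP (x \in s).
  (* A vertex outside [s] would give more than [#|L|] distinct vertices of [L]. *)
  have : size (x :: s) <= #|L|.
    by rewrite -(card_uniqP (_ : uniq (x :: s))) ?max_card //= xs.
  by rewrite /= sz ltnn.
have oL := index_strict_linear_order s_all.
exists (fun x z => index x s < index z s); rewrite /greedy_matching run //.
have satP : saturating P by apply/forallP => x; rewrite sP.
(* The bound [k] on [N] passes to its subset [P], so the least bound [j] for [P] is at most [k]. *)
split=> //; rewrite /matching_order satP /=; case: ex_minnP => j _; apply.
apply/unmatched_beyondP => e /(subsetP sPN); exact/unmatched_beyondP.
Qed.
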